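(* Let $\varrho$ be an aperiodic, primitive, bijective substitution of constant length $L\geqslant 2$ on a finite alphabet $\mathcal{A}$ of $n$ letters, with columns $\varrho_0,\dots,\varrho_{L-1}$ seen as elements of $S_n$ (the group of permutations of $\mathcal{A}$). Suppose further that $\varrho_i=\varrho_{L-(i+1)}=\mathrm{id}$ for some $0\leqslant i\leqslant L-1$. Then, given a permutation $\pi\in S_n$, $\pi\colon\mathcal{A}\to\mathcal{A}$, the following are equivalent: (i) The permutation $\pi$ gives rise to a reversing symmetry $f\in\mathcal{R}(\mathbb{X}_\varrho)\setminus\mathcal{S}(\mathbb{X}_\varrho)$ given by either $f(x)_m=\pi(x_{-m})$ for all $m\in\mathbb{Z}$ or $f(x)_m=\pi(x_{1-m})$ for all $m\in\mathbb{Z}$. (ii) The permutation $\pi$ satisfies $$\pi^{-1}\circ\varrho_i\circ\pi=\varrho_{L-(i+1)}\qquad\text{for all } 0\leqslant i\leqslant L-1.$$ (iii) There exist $\kappa_0,\kappa_1,\dots,\kappa_{L-1}\in S_n$, where each $\kappa_i$ satisfies $\kappa_i^{-1}\circ\varrho_i\circ\kappa_i=\varrho_{L-(i+1)}$, such that the intersection of cosets $$K=\bigcap_{i=0}^{L-1}\operatorname{cent}_{S_n}(\varrho_i)\,\kappa_i$$ is non-empty, and $\pi\in K$.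
   Context: Let $\mathcal{A}$ be a finite alphabet. A substitution of constant length $L$ is a map $\varrho\colon\mathcal{A}\to\mathcal{A}^L$, extended to words by concatenation. It is primitive if there is $k\geqslant 1$ such that $\varrho^k(a)$ contains every letter of $\mathcal{A}$ for every $a\in\mathcal{A}$. Its columns are the maps $\varrho_j\colon\mathcal{A}\to\mathcal{A}$, $\varrho_j(a)=\varrho(a)_j$, for $0\leqslant j\leqslant L-1$; $\varrho$ is bijective if every column is a bijection of $\mathcal{A}$. The hull $\mathbb{X}_\varrho\subseteq\mathcal{A}^{\mathbb{Z}}$ is the set of all $x\in\mathcal{A}^{\mathbb{Z}}$ all of whose finite subwords are subwords of some $\varrho^k(a)$, $k\geqslant 1$, $a\in\mathcal{A}$; it carries the product topology and the shift $\sigma$, $\sigma(x)_m=x_{m+1}$. It (and $\varrho$) is called aperiodic if no $x\in\mathbb{X}_\varrho$ satisfies $\sigma^n(x)=x$ for some $n\neq 0$. $\mathcal{S}(\mathbb{X}_\varrho)$ is the group of homeomorphisms $f$ of $\mathbb{X}_\varrho$ with $f\circ\sigma\circ f^{-1}=\sigma$, and $\mathcal{R}(\mathbb{X}_\varrho)$ is the group of homeomorphisms $f$ of $\mathbb{X}_\varrho$ with $f\circ\sigma\circ f^{-1}=\sigma^{\pm1}$. $\operatorname{cent}_{S_n}(g)$ denotes the centraliser of $g$ in $S_n$. *)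

(* Defs.v *)
From HB Require Import structures.
From mathcomp Require Import all_boot all_order all_algebra all_fingroup.
From mathcomp Require Import all_classical topology.

Set Implicit Arguments.
Unset Strict Implicit.
Unset Printing Implicit Defensive.

Import Order.TTheory GRing.Theory Num.Theory.

Local Open Scope classical_set_scope.
Local Open Scope ring_scope.

(* MathComp multiplies permutations from left to right, (s * t) x = t (s x);
   [s \po t] is the composition of maps, x |-> s (t x). *)
Definition pcomp (A : finType) (s t : {perm A}) : {perm A} := (t * s)%g.

Notation "s \po t" := (pcomp s t) (at level 50, left associativity).

(* The right coset cent(g) k for the product [\po]; it is the left coset
   [k *: 'C[g]] for the product of [{perm A}]. *)
Definition cent_coset (A : finType) (g k : {perm A}) : {set {perm A}} :=
  [set c \po k | c in 'C[g]%g]%SET.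

Section Substitution.
Variables (A : finType) (L : nat) (rho : A -> L.-tuple A).

Definition subst_word (w : seq A) : seq A := flatten [seq val (rho a) | a <- w].

Definition subst_iter (k : nat) (a : A) : seq A := iter k subst_word [:: a].

Definition primitive_subst : Prop :=
  exists2 k, (1 <= k)%N & forall a b : A, b \in subst_iter k a.

Definition column (j : 'I_L) (a : A) : A := tnth (rho a) j.

Definition bijective_subst : Prop := forall j : 'I_L, bijective (column j).

Definition column_perm (h : bijective_subst) (j : 'I_L) : {perm A} :=
  perm (bij_inj (h j)).

End Substitution.

Notation full_shift A := {ptws int -> discrete_topology A}.

(* [shift n] is the power sigma^n, n in Z, of the shift sigma = [shift 1]. *)
Definition shift (A : finType) (n : int) (x : full_shift A) : full_shift A :=
  fun m => x (m + n).

Definition subword (A : finType) (x : full_shift A) (m : int) (l : nat) :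
    seq A :=
  [seq x (m + k%:Z) | k <- iota 0 l].

Section Hull.
Variables (A : finType) (L : nat) (rho : A -> L.-tuple A).

Definition hull : set (full_shift A) :=
  [set x | forall m l, exists k a,
     (1 <= k)%N /\ infix (subword x m l) (subst_iter rho k a)].

Definition aperiodic_subst : Prop :=
  forall x, hull x -> forall n : int, n != 0 -> shift n x <> x.

Lemma hull_shift (n : int) (x : full_shift A) : hull x -> hull (shift n x).
Proof.
move=> hx m l; have [k [a [k1 inf]]] := hx (m + n) l.
exists k, a; split=> //; move: inf; congr (infix _ _).
by apply: eq_map => i; rewrite /shift addrAC.
Qed.

Definition hull_sigma (n : int) (x : hull) : hull :=
  SigSub (mem_set (hull_shift n (set_valP x))).

(* [hull], used as a type, carries the topology induced by [full_shift A];
   [g] is the inverse of [f]. *)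
Definition hull_homeo (f g : hull -> hull) : Prop :=
  [/\ continuous f, continuous g, cancel f g & cancel g f].

Definition symmetries : set (hull -> hull) :=
  [set f | exists2 g, hull_homeo f g &
     f \o hull_sigma 1 \o g = hull_sigma 1].

Definition reversing_symmetries : set (hull -> hull) :=
  [set f | exists2 g, hull_homeo f g &
     f \o hull_sigma 1 \o g = hull_sigma 1 \/
     f \o hull_sigma 1 \o g = hull_sigma (-1)].

End Hull.

Arguments symmetries {A L} rho _.
Arguments reversing_symmetries {A L} rho _.

(* Main.v *)
Require Import Defs.
From mathcomp Require Import all_boot all_order all_algebra all_fingroup.
From mathcomp Require Import all_classical topology.
From mathcomp Require Import zify.

(* Condition (ii) says that rho commutes with w |-> pi (rev w), so (ii) => (i) is
   seen on the words rho^k (a). For (i) => (ii), let w be the image under the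
   reversal of a point rho (y) of the hull. As a point of the hull, w is also cut
   into blocks rho (z_k), possibly at an offset s with respect to the blocks of
   rho (y). If s were not 0 modulo L, overlapping blocks and the bijectivity of
   the columns would give z_(k+1) = t (z_k) for a fixed permutation t, and w would
   be periodic. So the cuts agree: pi (rho_(L-1-j) (y_(-k))) = rho_j (z_k) for all
   j; a j for which both columns are the identity gives z_k = pi (y_(-k)), and
   every letter occurs in a suitable y. *)

Set Implicit Arguments.
Unset Strict Implicit.
Unset Printing Implicit Defensive.

Import Order.TTheory GRing.Theory Num.Theory.

Local Open Scope classical_set_scope.
Local Open Scope ring_scope.

(** * Windows of points, inflation and desubstitution *)

Lemma infix_subwordP (A : finType) (a0 : A) (x : full_shift A) m l w :
  reflect (exists2 q, (q + l <= size w)%N &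
             forall j, (j < l)%N -> x (m + j%:Z) = nth a0 w (q + j))
          (infix (subword x m l) w).
Proof.
apply: iffP; first exact: seq.infixP.
  move=> [u [v ->]]; have sz : size (subword x m l) = l.
    by rewrite size_map size_iota.
  exists (size u) => [|j jl]; first by rewrite !size_cat sz addnA leq_addr.
  rewrite nth_cat ltnNge leq_addr addKn nth_cat sz jl.
  by rewrite (nth_map 0%N) ?size_iota // nth_iota.
move=> [q le_w xE]; exists (take q w), (drop (q + l) w).
suff -> : subword x m l = take l (drop q w).
  by rewrite addnC -drop_drop !cat_take_drop.
apply: (@eq_from_nth _ a0) => [|j].
  by rewrite size_map size_iota size_takel // size_drop; lia.
rewrite size_map size_iota => jl.
by rewrite (nth_map 0%N) ?size_iota // nth_iota // xE // nth_take // nth_drop.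
Qed.

Section Words.
Variables (A : finType) (L : nat) (rho : A -> L.-tuple A).
Implicit Types (w : seq A) (x y : full_shift A).

Lemma size_subst_word w : size (subst_word rho w) = (size w * L)%N.
Proof.
elim: w => [|a w IH]; first by rewrite mul0n.
by rewrite /subst_word /= size_cat size_tuple [size (flatten _)]IH mulSn.
Qed.

Lemma size_subst_iter k a : size (subst_iter rho k a) = (L ^ k)%N.
Proof. by elim: k => //= k IH; rewrite size_subst_word IH expnSr. Qed.

Lemma nth_subst_word a0 w q (j : 'I_L) : (q < size w)%N ->
  nth a0 (subst_word rho w) (q * L + j) = column rho j (nth a0 w q).
Proof.
elim: w q => // a w IH [|q] /= qw.
  by rewrite mul0n nth_cat size_tuple ltn_ord /column (tnth_nth a0).
by rewrite nth_cat size_tuple mulSn -addnA ltnNge leq_addr addKn IH.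
Qed.

Lemma divn_ord q : (0 < L)%N -> exists k (j : 'I_L), q = (k * L + j)%N.
Proof.
by move=> L0; exists (q %/ L)%N, (Ordinal (ltn_pmod q L0)); rewrite -divn_eq.
Qed.

Lemma divz_ord (m : int) : (0 < L)%N ->
  exists k (j : 'I_L), m = k * L%:Z + j%:Z.
Proof.
move=> L0; have Lz : L%:Z != 0 by lia.
have lt_mod : (`|(m %% L)%Z| < L)%N.
  by have := modz_ge0 m Lz; have := ltz_mod m Lz; lia.
exists (m %/ L)%Z, (Ordinal lt_mod) => /=.
by rewrite gez0_abs ?modz_ge0 // -divz_eq.
Qed.

(* [rho (y)] on bi-infinite words, with the block [rho (y 0)] starting at 0 *)
Definition inflate y : full_shift A :=
  fun m => nth (y 0) (rho (y (m %/ L)%Z)) `|(m %% L)%Z|.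

Lemma inflateE y k (j : 'I_L) :
  inflate y (k * L%:Z + j%:Z) = column rho j (y k).
Proof.
have jL := ltn_ord j; have L0 : L%:Z != 0 by lia.
rewrite /inflate divzMDl // modzMDl divz_small ?modz_small ?addr0; last 2 first.
- by rewrite lez_nat ltz_nat leq0n.
- by lia.
by rewrite /column (tnth_nth (y 0)).
Qed.

Lemma iter_inflateE y K q : (0 < L)%N -> (q < L ^ K)%N ->
  iter K inflate y q%:Z = nth (y 0) (subst_iter rho K (y 0)) q.
Proof.
move=> L0; elim: K q => [|K IH] q; first by case: q.
have [k [j ->]] := divn_ord q L0; rewrite expnSr => lt_q.
have kK : (k < L ^ K)%N by rewrite -(ltn_pmul2r L0); lia.
by rewrite iterS PoszD PoszM inflateE IH //= nth_subst_word // size_subst_iter.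
Qed.

Lemma hull_inflate y : (0 < L)%N -> hull rho y -> hull rho (inflate y).
Proof.
move=> L0 hy m l; have [k0 [i ->]] := divz_ord m L0.
(* A window of length [l] starting inside a block meets at most [l.+1] blocks. *)
have [k [a [k1 /(infix_subwordP (y 0))[q le_q yE]]]] := hy k0 l.+1.
exists k.+1, a; split=> //; apply/(infix_subwordP (y 0)).
have iL := ltn_ord i.
have le_l : (l <= l * L)%N by rewrite leq_pmulr.
have le_qL := leq_mul le_q (leqnn L).
rewrite mulnDl mulSn in le_qL.
exists (q * L + i)%N => [|j jl]; first by rewrite /= size_subst_word; lia.
have [r [s rsE]] := divn_ord (i + j) L0.
have rl : (r < l.+1)%N by rewrite -(ltn_pmul2r L0) mulSn; lia.
have -> : k0 * L%:Z + i%:Z + j%:Z = (k0 + r%:Z) * L%:Z + s%:Z by lia.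
have -> : (q * L + i + j = (q + r) * L + s)%N by lia.
by rewrite inflateE yE // /= nth_subst_word //; lia.
Qed.

Lemma hull_iter_inflate y K : (0 < L)%N ->
  hull rho y -> hull rho (iter K inflate y).
Proof. by move=> L0 hy; elim: K => //= K; apply: hull_inflate. Qed.

(** Compactness: an ultrafilter on the indices [N] selects one value at each coordinate, since [A]
    is finite. A window involves finitely many coordinates, so it agrees with one of the words for
    some large [N]. *)
Lemma hull_nonempty : (2 <= L)%N -> A -> exists x, hull rho x.
Proof.
move=> L2 a0.
(* The origin is placed at index [N] of a word longer than [2N + 1], so every fixed window fits once
   [N] is large. *)
pose u N (m : int) := nth a0 (subst_iter rho N.*2.+1 a0) (absz (N%:Z + m)).
have [G [GU leG]] := ultraFilterLemma eventually_filter.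
have /choice[x xE] m : exists b, G [set N | u N m = b].
  apply: contrapT => /forallNP noG.
  have : \forall N \near G, forall b, u N m <> b.
    apply: filter_forall => b.
    by case: (in_ultra_setVsetC [set N | u N m = b] GU) => // /noG.
  by move=> /filter_ex[N /(_ (u N m))].
exists x => m l.
have Gu : \forall N \near G, forall j : 'I_l, u N (m + j%:Z) = x (m + j%:Z).
  by apply: filter_forall => j; exact: xE.
have Gbig : \forall N \near G, (absz m + l <= N)%N by apply: leG; exact: nbhs_infty_ge.
have [N [uN leN]] := filter_ex (filterI Gu Gbig).
exists N.*2.+1, a0; split=> //; apply/(infix_subwordP a0).
exists (absz (N%:Z + m)) => [|j jl].
  by rewrite size_subst_iter; have := ltn_expl N.*2.+1 L2; lia.
by rewrite -(uN (Ordinal jl)) /u /=; congr nth; lia.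
Qed.

(** By primitivity [a] occurs in [rho^K (x 0)], the word that the [K]-fold inflation of [x] shows
    from position 0 on. *)
Lemma mem_hull (a : A) : (2 <= L)%N -> primitive_subst rho ->
  exists2 x, hull rho x & exists k, x k = a.
Proof.
move=> L2 [K _ prim]; have L0 := ltnW L2.
have [x hx] := hull_nonempty L2 a.
exists (iter K inflate x); first exact: hull_iter_inflate.
have aK := prim (x 0) a.
exists (index a (subst_iter rho K (x 0)))%:Z.
by rewrite iter_inflateE ?nth_index // -(size_subst_iter K (x 0)) index_mem.
Qed.

(* The cutting offset [s] is chosen for each window of [x]; as there are finitely
   many, one of them serves arbitrarily large windows, hence all. *)
Lemma hull_desubst x : (0 < L)%N -> hull rho x ->
  exists (s : 'I_L) (z : int -> A), forall k (j : 'I_L),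
    x (k * L%:Z + s%:Z + j%:Z) = column rho j (z k).
Proof.
move=> L0 hx.
pose P (s : 'I_L) N := forall k : int, (absz k < N)%N ->
  exists b, forall j : 'I_L, x (k * L%:Z + s%:Z + j%:Z) = column rho j b.
have exP N : exists s, P s N.
  (* The window leaves room for the blocks [k] with [|k| < N] after a shift by less than [L]. *)
  have [k [a [k1 /(infix_subwordP (x 0))[q le_q xE]]]] :=
    hx (- N%:Z * L%:Z) (N.*2.+1 * L)%N.
  case: k k1 le_q xE => // k _ le_q xE.
  have [t [r qE]] := divn_ord q L0; have rL := ltn_ord r.
  (* This is the distance from [q] to the next multiple of [L]; it is 0 when [r = 0]. *)
  have sL : ((L - r) %% L < L)%N by rewrite ltn_mod.
  have [d dE] : exists d, (q + (L - r) %% L = d * L)%N.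
    have [r0|r0] := posnP r.
      by exists t; rewrite r0 subn0 modnn qE r0 !addn0.
    by exists t.+1; rewrite modn_small ?mulSn; lia.
  exists (Ordinal sL) => n lt_nN /=; set s := ((L - r) %% L)%N in sL dE *.
  have [i nE] : exists i : nat, n = i%:Z - N%:Z by exists (absz (n + N%:Z)); lia.
  have le_iN : (i.+2 * L <= N.*2.+1 * L)%N by rewrite leq_pmul2r //; lia.
  rewrite !mulSn in le_iN.
  exists (nth (x 0) (subst_iter rho k a) (d + i)) => j.
  have jL := ltn_ord j.
  have -> : n * L%:Z + s%:Z + j%:Z = - N%:Z * L%:Z + (i * L + s + j)%N%:Z by lia.
  rewrite xE ?mulSn; last by lia.
  have -> : (q + (i * L + s + j) = (d + i) * L + j)%N by rewrite mulnDl -dE; lia.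
  rewrite nth_subst_word // -(ltn_pmul2r L0) mulnDl -size_subst_word -dE.
  rewrite mulSn in le_q.
  by apply: leq_trans le_q; lia.
have [s Ps] : exists s, forall N, P s N.
  (* A failure of [P s N0] persists for all [N >= N0], so otherwise all offsets would fail at a
     common [N]. *)
  apply: contrapT => /forallNP noP.
  have : \forall N \near \oo, forall s, ~ P s N.
    apply: filter_forall => s; have /existsNP[N0 nP] := noP s.
    apply: filterS (nbhs_infty_ge N0) => N /= leN PN; apply: nP => k ltk.
    exact: PN (leq_trans ltk leN).
  by move=> /filter_ex[N]; have [s Ps] := exP N; move=> /(_ s).
by have /choice[z zE] k := Ps (absz k).+1 k (ltnSn _); exists s, z.
Qed.

End Words.

(** * Reversals and the conjugation of columns *)

Lemma perm_orbit_periodic (A : finType) (t : {perm A}) (z : int -> A) :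
  (forall k, z (k + 1) = t (z k)) ->
  exists2 n, (0 < n)%N & forall k, z (k + n%:Z) = z k.
Proof.
move=> zS; exists #[t]%g => [|k]; first exact: order_gt0.
have zn n : z (k + n%:Z) = iter n t (z k).
  by elim: n => [|n IH]; rewrite ?addr0 // intS addrCA addrC zS IH.
by rewrite zn -permX expg_order perm1.
Qed.

(** The values [c = 0] and [c = 1] give the two forms in (i); [c = L - 1] carries the block at [k L]
    onto the block at [- k L]. *)
Definition flip (A : finType) (p : {perm A}) (c : int) (x : full_shift A) :
  full_shift A := fun m => p (x (c - m)).

Section Reversal.
Variables (A : finType) (L : nat) (rho : A -> L.-tuple A).
Variables (hbij : bijective_subst rho) (p : {perm A}).

Lemma column_permE j a : column_perm hbij j a = column rho j a.
Proof. exact: permE. Qed.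

(* If the cuts of [flip p _ (inflate rho y)] were offset by [s > 0], each block
   [rho (z k)] would determine [y (- k - 1)] and then [rho (z (k + 1))], since
   columns are bijective; so [z] would be periodic. *)
Lemma flip_inflate_aligned y : (0 < L)%N -> aperiodic_subst rho ->
  hull rho (flip p L.-1%:Z (inflate rho y)) ->
  exists z, forall k (j : 'I_L),
    p (column rho (rev_ord j) (y k)) = column rho j (z k).
Proof.
move=> L0 hap hw; have [s [z zE]] := hull_desubst L0 hw.
have wE k (j : 'I_L) : flip p L.-1%:Z (inflate rho y) (k * L%:Z + j%:Z) =
    p (column rho (rev_ord j) (y (- k))).
  rewrite /flip -inflateE /=; congr (p (inflate _ _ _)).
  by have := ltn_ord j; lia.
have [s0|s_gt0] := posnP s.
  exists (fun k => z (- k)) => k j.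
  by rewrite -zE s0 addr0 wE opprK.
have sL := ltn_ord s.
pose o0 := Ordinal L0; have LsL : (L - s < L)%N by lia.
pose oLs := Ordinal LsL; pose cp := column_perm hbij.
(* Letter [L - s] of [rho (z k)] is the first letter of the reversed block of [y (- k - 1)] and so
   determines [y (- k - 1)]; letter [s] of that reversed block is the first letter of
   [rho (z (k + 1))]. *)
pose t := (cp oLs * p^-1 * (cp (rev_ord o0))^-1 * cp (rev_ord s) * p *
           (cp o0)^-1)%g.
have [|n n0 zn] := @perm_orbit_periodic _ t z.
  move=> k; rewrite /t !permM; apply: (canRL (permK (cp o0))).
  rewrite column_permE -zE /= addr0 wE -column_permE.
  congr (p (cp _ _)); apply: (canRL (permK (cp (rev_ord o0)))).
  apply: (canRL (permK p)); rewrite !column_permE -wE -zE /=.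
  by congr (flip _ _ _ _); lia.
suff : shift (n%:Z * L%:Z) (flip p L.-1%:Z (inflate rho y)) =
    flip p L.-1%:Z (inflate rho y) by case/hap => //; lia.
apply/funext => m; rewrite /shift.
have [k [j mE]] := divz_ord (m - s%:Z) L0.
have -> : m = k * L%:Z + s%:Z + j%:Z by lia.
rewrite zE -zn -zE; congr (flip _ _ _ _); lia.
Qed.

Lemma conj_of_hull_flip c : (2 <= L)%N -> aperiodic_subst rho -> primitive_subst rho ->
  (exists i : 'I_L, column_perm hbij i = 1%g /\
                    column_perm hbij (rev_ord i) = 1%g) ->
  (forall x, hull rho x -> hull rho (flip p c x)) ->
  forall j a, column rho j (p a) = p (column rho (rev_ord j) a).
Proof.
move=> L2 hap hprim [i [ci cri]] hp j a; have L0 := ltnW L2.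
have [y hy [k <-]] := mem_hull a L2 hprim.
have [|z zE] := @flip_inflate_aligned y L0 hap.
  (* A shift recentres the reflection so that it maps blocks onto blocks. *)
  have -> : flip p L.-1%:Z (inflate rho y) =
      shift (c - L.-1%:Z) (flip p c (inflate rho y)).
    by apply/funext => m; rewrite /flip /shift; congr (p (inflate _ _ _)); lia.
  by apply/hull_shift/hp/hull_inflate.
rewrite zE; congr (column _ _ _).
(* Both columns are the identity at [i], which leaves [p (y k) = z k]. *)
by have := zE k i; rewrite -!column_permE ci cri !perm1.
Qed.

Hypothesis conj_p : forall j a, column rho j (p a) = p (column rho (rev_ord j) a).

Lemma rho_flip a : rho (p a) = map p (rev (rho a)) :> seq A.
Proof.
apply: (@eq_from_nth _ a) => [|q].
  by rewrite size_map size_rev !size_tuple.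
rewrite size_tuple => qL.
have -> : nth a (rho (p a)) q = column rho (Ordinal qL) (p a).
  by rewrite /column (tnth_nth a).
rewrite conj_p (nth_map a) ?size_rev ?size_tuple // nth_rev ?size_tuple //.
by rewrite /column (tnth_nth a).
Qed.

(** Reversing a concatenation reverses the order of the blocks, and [rho_flip] treats each block. *)
Lemma subst_iter_flip k a :
  subst_iter rho k (p a) = map p (rev (subst_iter rho k a)).
Proof.
elim: k => //= k ->; rewrite /subst_word rev_flatten map_flatten -!map_rev.
by congr flatten; rewrite -!map_comp; apply: eq_map => b /=; exact: rho_flip.
Qed.

Lemma hull_flip x : hull rho x -> hull rho (flip p 0 x).
Proof.
(* The positions [m, ..., m + l - 1] reflect to [1 - m - l, ..., - m]. *)
move=> hx m l; have [k [a [k1 xE]]] := hx (1 - m - l%:Z) l.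
exists k, (p a); split=> //; rewrite subst_iter_flip.
have -> : subword (flip p 0 x) m l = map p (rev (subword x (1 - m - l%:Z) l)).
  apply: (@eq_from_nth _ a) => [|j].
    by rewrite !(size_map, size_rev, size_iota).
  rewrite size_map size_iota => jl.
  rewrite (nth_map 0%N) ?size_iota // nth_iota // /flip.
  rewrite (nth_map a) ?(size_map, size_rev, size_iota) //.
  rewrite nth_rev ?(size_map, size_iota) // (nth_map 0%N) ?size_iota ?nth_iota; try lia.
  by congr (p (x _)); lia.
move: xE => /infixP[u [v ->]].
by rewrite !rev_cat !map_cat -catA; apply: infix_infix.
Qed.

End Reversal.

(** * Continuity of reversals and the three equivalent conditions *)

(** Coordinate [m] of [f x] depends only on coordinate [c - m] of [x], and the letters are
    discrete. *)
Lemma continuous_flip (A : finType) (L : nat) (rho : A -> L.-tuple A)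
    (p : {perm A}) c (f : hull rho -> hull rho) :
  (forall x, val (f x) = flip p c (val x)) -> continuous f.
Proof.
move=> fE; apply: continuous_comp_initial => x.
apply/cvg_sup => [|m U [V [[W oW <-]] Wfx WU]]; first exact/fmap_filter/nbhs_filter.
have fxE y : val (f y) m = p (val y (c - m)) by rewrite fE.
have Wproj : nbhs (proj (c - m) (val x)) [set a | W (p a)].
  apply: open_nbhs_nbhs; split; first exact: discrete_open.
  by rewrite /= /proj -fxE.
have := @initial_continuous _ _ (@set_val _ (hull rho)) x _
  (@proj_continuous _ (fun=> discrete_topology A) (c - m) _ _ Wproj).
move/(@filterS _ (nbhs x) _ _ ((set_val \o f) @^-1` U)); apply => y Wy; apply: WU.
by move: Wy; rewrite /= /proj -fxE.
Qed.

Lemma perm_conjP (A : finType) (s t p : {perm A}) :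
  p^-1%g \po s \po p = t <-> forall a, s (p a) = p (t a).
Proof.
split=> [<- a|st]; first by rewrite /pcomp !permM permKV.
by apply/permP => a; rewrite /pcomp !permM st permK.
Qed.

Theorem theorem22 (A : finType) (L : nat) (rho : A -> L.-tuple A)
    (hA : (0 < #|A|)%N) (hL : (2 <= L)%N)
    (hap : aperiodic_subst rho) (hprim : primitive_subst rho)
    (hbij : bijective_subst rho)
    (hid : exists i : 'I_L, column_perm hbij i = 1%g /\
                            column_perm hbij (rev_ord i) = 1%g)
    (pi : {perm A}) :
  [<->
    (* (i) *)
    exists f : hull rho -> hull rho,
      (reversing_symmetries rho `\` symmetries rho) f /\
      ((forall (x : hull rho) (m : int), val (f x) m = pi (val x (- m))) \/
       (forall (x : hull rho) (m : int), val (f x) m = pi (val x (1 - m))));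
    (* (ii) *)
    forall i : 'I_L,
      pi^-1%g \po column_perm hbij i \po pi = column_perm hbij (rev_ord i);
    (* (iii) *)
    exists kappa : 'I_L -> {perm A},
      (forall i : 'I_L,
         (kappa i)^-1%g \po column_perm hbij i \po kappa i
           = column_perm hbij (rev_ord i)) /\
      (let K := (\bigcap_(i < L)
                   cent_coset (column_perm hbij i) (kappa i))%SET in
       K != finset.set0 /\ pi \in K)].
Proof.
have L0 := ltnW hL; have /card_gt0P[a0 _] := hA.
set ii := (X in [<-> _; X; _]).
have conjP : ii <-> forall j a,
    column rho j (pi a) = pi (column rho (rev_ord j) a).
  split=> [h j a|h j]; last by apply/perm_conjP => a; rewrite !column_permE.
  by rewrite -!(column_permE hbij); move/perm_conjP: (h j).
tfae.
- move=> [f [_ fE]]; apply/conjP.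
  have [c hc] : exists c, forall x : hull rho, val (f x) = flip pi c (val x).
    by case: fE => fE; [exists 0|exists 1] => x; apply/funext => m;
      rewrite fE /flip ?sub0r.
  apply: (@conj_of_hull_flip _ _ _ hbij pi c) => // x hx.
  by rewrite -[x]/(val (SigSub (mem_set hx) : hull rho)) -hc; apply: set_valP.
(* With every [kappa i] equal to [pi], each coset contains [pi] through the identity. *)
- move=> h; exists (fun=> pi); split=> // K.
  have piK : pi \in K.
    apply/bigcapP => i _; apply/imsetP; exists 1%g.
      exact: group1.
    by apply/permP => a; rewrite /pcomp permM perm1.
  by split=> //; apply/set0Pn; exists pi.
- move=> [kappa [hk [_ /bigcapP piK]]].
  have {}hk : forall j a, column rho j (pi a) = pi (column rho (rev_ord j) a).
    (* Here [pi] is [kappa i] followed by some [c] commuting with column [i], so both conjugate this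
       column alike. *)
    apply/conjP => i; have /imsetP[c /cent1P cc piE] := piK i isT.
    have cs b : column_perm hbij i (c b) = c (column_perm hbij i b).
      by rewrite -!permM cc.
    apply/perm_conjP => b; rewrite piE /pcomp !permM cs.
    by congr (c _); have /perm_conjP := hk i; apply.
  (* As [rev_ord] is an involution, the inverse of [pi] also satisfies (ii); it yields the inverse
     map on the hull. *)
  have hkV j a : column rho j (pi^-1%g a) = pi^-1%g (column rho (rev_ord j) a).
    by apply: (canRL (permK pi)); rewrite -[X in column rho X]rev_ordK -hk permKV.
  pose F (p : {perm A})
      (hp : forall j a, column rho j (p a) = p (column rho (rev_ord j) a))
      (x : hull rho) : hull rho :=
    SigSub (mem_set (hull_flip hp (set_valP x))).
  have FE p hp x : val (@F p hp x) = flip p 0 (val x) by [].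
  exists (F _ hk); split; last by left=> x m; rewrite FE /flip sub0r.
  have FK : cancel (F _ hk) (F _ hkV).
    by move=> x; apply/val_inj/funext => m; rewrite !FE /flip permK; congr (val x _); lia.
  have FVK : cancel (F _ hkV) (F _ hk).
    by move=> x; apply/val_inj/funext => m; rewrite !FE /flip permKV; congr (val x _); lia.
  have Fsigma : F _ hk \o hull_sigma 1 \o F _ hkV = hull_sigma (-1).
    apply/funext => x; apply/val_inj/funext => m.
    by rewrite /= /flip /shift /= permKV; congr (val x _); lia.
  split.
    exists (F _ hkV); last by right.
    by split=> //; apply: continuous_flip; exact: FE.
  (* If the map were a symmetry, the shift would equal its inverse, and a point of the hull would
     have period 2. *)
  move=> [g [_ _ Fg gF]].
  have -> : g = F _ hkV.
    by apply/funext => x; rewrite -[LHS]FK gF.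
  rewrite Fsigma => sE; have [x hx] := hull_nonempty rho hL a0.
  have := hap x hx 2 isT; apply.
  apply/funext => m.
  have /(congr1 (fun h => val (h (SigSub (mem_set hx))) (m + 1))) := sE.
  rewrite /= /shift addrK -addrA => <-.
  by congr x; lia.
Qed.
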